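(* Let $F$ be a field of characteristic zero, $t\in F$ and $q\in F\setminus\{0\}$. Then there is a faithful functor $$\mathcal F:\operatorname{gr}\underline{\operatorname{Rep}}(S_t)_q\to\underline{\operatorname{Rep}}(S_t).$$ This functor is induced (by passing to the additive and then the Karoubian envelopes) by the functor $\mathcal F_0:\operatorname{gr}\underline{\operatorname{Rep}}_0(S_t)_q\to\underline{\operatorname{Rep}}_0(S_t)$ given on objects by $\mathcal F_0([a,b])=[a+b]$ for all $a,b\in\mathbb Z_{\ge0}$, and on morphisms by the identity: for $f\in\operatorname{Hom}_{\operatorname{gr}\underline{\operatorname{Rep}}_0(S_t)}([a,b],[c,d])\subseteq FP_{a+b,c+d}$, $\mathcal F_0(f)=f:[a+b]\to[c+d]$.
   Context: For $a,b\ge 0$, $FP_{a,b}=FP_{a,b}(t)$ is the $F$-vector space with basis the set partitions (partition diagrams) of $\{1,\dots,a,1',\dots,b'\}$ (unprimed = top, primed = bottom). For diagrams $\pi$ in $FP_{a,b}$ and $\mu$ in $FP_{b,c}$, the composite $\mu\pi\in FP_{a,c}$ is obtained by stacking $\pi$ on top of $\mu$, identifying bottom vertices of $\pi$ with top vertices of $\mu$, taking the induced partition on the outer vertices, and multiplying by $t^\ell$, where $\ell$ is the number of connected components consisting only of middle vertices. $\underline{\operatorname{Rep}}_0(S_t)$ is the category with objects $[n]$, $n\in\mathbb Z_{\ge0}$, with $\operatorname{Hom}([a],[b])=FP_{a,b}(t)$, and with the composite of $\pi:[a]\to[b]$ and $\mu:[b]\to[c]$ given by the bilinear extension of the vertical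 concatenation product $(\mu,\pi)\mapsto\mu\pi\in FP_{a,c}(t)$ of partition diagrams ($\pi$ stacked on top of $\mu$, with a factor $t$ for each connected component consisting only of middle vertices). Deligne's category $\underline{\operatorname{Rep}}(S_t)$ is the Karoubian envelope of the additive envelope of $\underline{\operatorname{Rep}}_0(S_t)$. $\operatorname{gr}\underline{\operatorname{Rep}}_0(S_t)_q$ is the category with objects all pairs $[a,b]$, $a,b\in\mathbb Z_{\ge0}$ (the object $[a,b]$ has degree $a-b$), and with $\operatorname{Hom}([a,b],[c,d])=FP_{a+b,c+d}$ if $a-b=c-d$ and $0$ otherwise; composition is the same vertical concatenation rule. (The parameter $q$ enters only through the braiding and twist of this category, not through its underlying category structure.) $\operatorname{gr}\underline{\operatorname{Rep}}(S_t)_q$ is the Karoubian envelope of the additive envelope of $\operatorname{gr}\underline{\operatorname{Rep}}_0(S_t)_q$. *)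

(* Defs.v *)
From HB Require Import structures.
From mathcomp Require Import all_boot all_order all_algebra.

Set Implicit Arguments.
Unset Strict Implicit.
Unset Printing Implicit Defensive.

Import GRing.Theory.
Local Open Scope ring_scope.

Definition rel_image (U V : finType) (f : U -> V) (r : rel U) : rel V :=
  fun x y => [exists u, exists v, [&& r u v, f u == x & f v == y]].

Definition components (V : finType) (r : rel V) : {set {set V}} :=
  equivalence_partition (connect r) [set: V].

Definition ncomp_in (V : finType) (r : rel V) (K : {set V}) : nat :=
  #|[set C in components r | C \subset K]|.

Lemma rel_imageP (U V : finType) (f : U -> V) (r : rel U) x y :
  reflect (exists u v, [/\ r u v, x = f u & y = f v]) (rel_image f r x y).
Proof.
apply: (iffP existsP) => [[u /existsP[v /and3P[ruv /eqP<- /eqP<-]]]|].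
  by exists u, v.
by case=> u [v [ruv -> ->]]; exists u; apply/existsP; exists v; rewrite ruv !eqxx.
Qed.

Lemma componentsP (V : finType) (r : rel V) C :
  reflect (exists x, C = [set y | connect r x y]) (C \in components r).
Proof.
apply: (iffP imsetP) => [[x _ ->]|[x ->]]; exists x => //;
by apply/setP=> y; rewrite !inE.
Qed.

Lemma connect_homo (U V : finType) (r : rel U) (s : rel V) (h : U -> V) :
  (forall u v, r u v -> connect s (h u) (h v)) ->
  forall u v, connect r u v -> connect s (h u) (h v).
Proof.
move=> rs u v /connectP[p]; elim: p u => [|w p IHp] u /=.
  by move=> _ ->; apply: connect0.
by case/andP=> /rs suw /IHp{}IHp /IHp; apply: connect_trans.
Qed.

Lemma connect_inv (V : finType) (r : rel V) (P : V -> Prop) x :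
  P x -> (forall y z, connect r x y -> P y -> r y z -> P z) ->
  forall y, connect r x y -> P y.
Proof.
move=> Px step y /connectP[p]; elim/last_ind: p y => [|p z IHp] y /=.
  by move=> _ ->.
rewrite rcons_path last_rcons => /andP[pth rz] ->.
by apply: step rz; [apply/connectP; exists p | apply: IHp].
Qed.

Section Elimination.

(* A graph on V glued from the graph r0 on U and the graph r2 on S along O;
   replacing r0 by the relation it induces on O eliminates the vertices
   of V which are not in S. *)
Variables (O U S V : finType).
Variables (o1 : O -> U) (o2 : O -> S) (g : U -> V) (f : S -> V).
Hypotheses (g_inj : injective g) (f_inj : injective f).
Hypothesis gf_comm : forall o, g (o1 o) = f (o2 o).
Hypothesis gf_pull : forall u s, g u = f s -> exists2 o, u = o1 o & s = o2 o.
Hypothesis gf_cover : forall x, (exists s, x = f s) \/ (exists u, x = g u).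
Variables (r0 : rel U) (r2 : rel S).
Hypotheses (r0_sym : symmetric r0) (r2_sym : symmetric r2).

Let rV := relU (rel_image g r0) (rel_image f r2).
Let rO := fun x y => connect r0 (o1 x) (o1 y).
Let rS := relU (rel_image o2 rO) r2.

Lemma rel_image_sym (A B : finType) (h : A -> B) r :
  symmetric r -> symmetric (rel_image h r).
Proof.
by move=> rC x y; apply/rel_imageP/rel_imageP=> -[u [v [ruv -> ->]]];
   exists v, u; rewrite rC.
Qed.

Let rV_sym : connect_sym rV.
Proof.
apply: sym_connect_sym => x y.
by rewrite /rV /= (rel_image_sym g r0_sym) (rel_image_sym f r2_sym).
Qed.

Let connect_gV u v : connect r0 u v -> connect rV (g u) (g v).
Proof.
apply: connect_homo => {}u {}v ruv; apply: connect1; apply/orP; left.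
by apply/rel_imageP; exists u, v.
Qed.

Lemma connect_elim s s' : connect rS s s' = connect rV (f s) (f s').
Proof.
apply/idP/idP.
  apply: connect_homo => {}s {}s' /orP[/rel_imageP[o [o' [roo -> ->]]]|rss].
    by rewrite -!gf_comm; apply: connect_gV.
  apply: connect1; apply/orP; right.
  by apply/rel_imageP; exists s, s'.
pose P z := exists2 t, connect rS s t &
  (f t = z \/ exists u u', [/\ g u = f t, g u' = z & connect r0 u u']).
have toS t u u' t' : g u = f t -> g u' = f t' -> connect r0 u u' -> rS t t'.
  move=> /gf_pull[o -> ->] /gf_pull[o' -> ->] c; apply/orP; left.
  by apply/rel_imageP; exists o, o'.
have PV z : connect rV (f s) z -> P z.
  apply: connect_inv z; first by exists s; [exact: connect0 | left].
  move=> y z _ [t cst ty] /orP[]/rel_imageP[u [v [ruv yE zE]]].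
    exists t => //; right; case: ty => [fty|[w [w' [gw gw' cw]]]].
      by exists u, v; rewrite fty yE zE; split=> //; apply: connect1.
    exists w, v; split=> //.
    have uw : u = w' by apply: g_inj; rewrite gw' yE.
    rewrite uw in ruv.
    exact: connect_trans cw (connect1 ruv).
  exists v; last by left.
  have cuv : connect rS u v by apply: connect1; rewrite /rS /= ruv orbT.
  case: ty => [fty|[w [w' [gw gw' cw]]]].
    by move: fty; rewrite yE => /f_inj tu; rewrite tu in cst; apply: connect_trans cuv.
  apply: connect_trans cst (connect_trans (connect1 _) cuv).
  by apply: toS gw _ cw; rewrite gw'.
case/PV=> t cst [/f_inj<- //|[u [u' [gu gu' cu]]]].
by apply: connect_trans cst (connect1 _); apply: toS gu gu' cu.
Qed.

Let M := [set x | x \notin codom f].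

Lemma comp_noS u :
  (forall u', connect r0 u u' -> g u' \in M) ->
  [set y | connect rV (g u) y] = g @: [set v | connect r0 u v].
Proof.
move=> uM; apply/setP=> y; rewrite inE; apply/idP/imsetP.
  have {}uM u' s : connect r0 u u' -> g u' <> f s.
    by move=> /uM; rewrite inE => /negP gu E; apply: gu; rewrite E codom_f.
  pose P z := exists2 v, connect r0 u v & z = g v.
  move=> cy; suff [v cv ->] : P y by exists v => //; rewrite inE.
  apply: (connect_inv (P := P)) cy; first by exists u; first exact: connect0.
  move=> {}y z _ [v cv ->] /orP[]/rel_imageP[w [w' [rw yE ->]]].
    exists w' => //; move/g_inj: yE => vw.
    by apply: connect_trans cv (connect1 _); rewrite vw.
  by case: (uM v w cv yE).
by case=> v; rewrite inE => cv ->; apply: connect_gV.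
Qed.

Lemma ncomp_noS : ncomp_in rV M = ncomp_in r0 [set u | u \notin codom o1].
Proof.
rewrite /ncomp_in -[RHS](card_imset _ (imset_inj g_inj)); congr #|pred_of_set _|.
have noO u : (u \notin codom o1) = (g u \in M).
  rewrite inE; congr negb; apply/codomP/codomP => [[o ->]|[s]].
    by exists (o2 o).
  by move/gf_pull=> [o -> _]; exists o.
apply/setP=> C; rewrite inE; apply/andP/imsetP.
  case=> /componentsP[x ->] xM; have: x \in M.
    by apply: (subsetP xM); rewrite inE connect0.
  rewrite inE; case: (gf_cover x) => [[s ->]|[u xu] _]; first by rewrite codom_f.
  have uM u' : connect r0 u u' -> g u' \in M.
    by move=> cu; apply: (subsetP xM); rewrite inE xu connect_gV.
  exists [set v | connect r0 u v]; last by rewrite xu comp_noS.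
  rewrite inE; apply/andP; split; first by apply/componentsP; exists u.
  by apply/subsetP=> v; rewrite !inE => /uM; rewrite -noO.
case=> D; rewrite inE => /andP[/componentsP[u ->] uM] ->.
have {}uM u' : connect r0 u u' -> g u' \in M.
  by move=> cu; rewrite -noO; have:= subsetP uM u'; rewrite !inE; apply.
split; first by apply/componentsP; exists (g u); rewrite comp_noS.
by apply/subsetP=> _ /imsetP[v cv ->]; apply: uM; rewrite inE in cv.
Qed.

Lemma ncomp_S (K : {set S}) :
  ncomp_in rS K =
  #|[set C in components rV | (C \subset f @: K :|: M) && ~~ (C \subset M)]|.
Proof.
have compS s : f @^-1: [set y | connect rV (f s) y] = [set s' | connect rS s s'].
  by apply/setP=> s'; rewrite !inE connect_elim.
have getS C : C \in components rV -> ~~ (C \subset M) ->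
    exists s, C = [set y | connect rV (f s) y].
  case/componentsP=> x ->; case/subsetPn=> y cy.
  rewrite !inE negbK in cy * => /codomP[s yE]; exists s.
  by apply/setP=> z; rewrite !inE -yE; apply: same_connect.
symmetry; rewrite -(@card_in_imset _ _ (fun C : {set V} => f @^-1: C)).
  congr #|pred_of_set _|; apply/setP=> D; rewrite inE; apply/imsetP/andP.
    case=> C; rewrite inE => /and3P[cC CK /getS[//|s E]] ->.
    rewrite E compS; split; first by apply/componentsP; exists s.
    apply/subsetP=> s'; rewrite inE connect_elim => cs.
    have: f s' \in C by rewrite E inE.
    move/(subsetP CK); rewrite !inE codom_f orbF => /imsetP[k kK /f_inj->].
    exact: kK.
  case=> /componentsP[s ->] sK; exists [set y | connect rV (f s) y].
    rewrite inE; apply/and3P; split; first by apply/componentsP; exists (f s).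
      apply/subsetP=> y; rewrite 2!inE => cy.
      have [/codomP[k yE]|ny] := boolP (y \in codom f); last by rewrite inE ny orbT.
      rewrite yE imset_f //; apply: (subsetP sK).
      by rewrite inE connect_elim -yE.
    by apply/subsetPn; exists (f s); rewrite !inE ?connect0 // codom_f.
  by rewrite compS.
move=> C D; rewrite !inE => /and3P[cC _ /getS[//|s ->]] /and3P[cD _ /getS[//|t ->]].
move/setP/(_ t); rewrite !inE connect0 => cst.
by apply/setP=> y; rewrite !inE; apply: same_connect.
Qed.

Lemma ncomp_elim (K : {set S}) :
  ncomp_in rV (f @: K :|: M)
  = (ncomp_in r0 [set u | u \notin codom o1] + ncomp_in rS K)%N.
Proof.
rewrite -ncomp_noS ncomp_S /ncomp_in.
rewrite -(cardsID [set C : {set V} | C \subset M]); congr (_ + _)%N;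
  congr #|pred_of_set _|; apply/setP=> C; rewrite !inE.
  apply/andP/andP => [[/andP[cC _] CM]|[cC CM]] //; rewrite cC; split=> //=.
  exact: subset_trans CM (subsetUr _ _).
by rewrite andbC -andbA.
Qed.

End Elimination.

(* Top vertices are the [inl i], bottom vertices are the [inr j]. *)
Definition diagram (a b : nat) :=
  {P : {set {set 'I_a + 'I_b}} | partition P [set: 'I_a + 'I_b]}.

Definition same_block a b (pi : diagram a b) : rel ('I_a + 'I_b) :=
  fun u v => v \in pblock (val pi) u.

Definition diagram_of_rel a b (R : rel ('I_a + 'I_b))
    (eqR : {in setT & &, equivalence_rel R}) : diagram a b :=
  exist _ (equivalence_partition R setT) (equivalence_partitionP eqR).

Lemma same_block_equiv a b (pi : diagram a b) : equivalence_rel (same_block pi).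
Proof.
by move=> x y z; apply: (pblock_equivalence (valP pi)); rewrite inE.
Qed.

Lemma same_block_refl a b (pi : diagram a b) : reflexive (same_block pi).
Proof. by move=> x; case: (same_block_equiv pi x x x). Qed.

Lemma same_block_ltrans a b (pi : diagram a b) : left_transitive (same_block pi).
Proof. by move=> x y xy z; case: (same_block_equiv pi x y z) => _ ->. Qed.

Lemma same_block_sym a b (pi : diagram a b) : symmetric (same_block pi).
Proof.
move=> x y; apply/idP/idP=> xy; by rewrite -(same_block_ltrans xy) same_block_refl.
Qed.

Lemma same_block_trans a b (pi : diagram a b) : transitive (same_block pi).
Proof. by move=> y x z xy yz; rewrite (same_block_ltrans xy). Qed.

Lemma same_block_of_rel a b R eqR u v :
  same_block (@diagram_of_rel a b R eqR) u v = R u v.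
Proof. by apply: (pblock_equivalence_partition eqR); rewrite inE. Qed.

Lemma diagram_eq a b (pi mu : diagram a b) :
  same_block pi =2 same_block mu -> pi = mu.
Proof.
have E (nu : diagram a b) :
    val nu = [set [set v | same_block nu u v] | u in [set: 'I_a + 'I_b]].
  case: nu => P partP; rewrite /same_block /=.
  case/and3P: (partP) => /eqP covP tiP P0.
  have memb u : [set v | v \in pblock P u] = pblock P u.
    by apply/setP=> v; rewrite inE.
  apply/setP=> B; apply/idP/imsetP=> [PB|[u _ ->]].
    have /set0Pn[u Bu] : B != set0 by apply: contraNneq P0 => <-.
    by exists u; rewrite ?inE // memb (def_pblock tiP PB Bu).
  by rewrite memb pblock_mem // covP inE.
move=> eq_pm; apply: val_inj; rewrite !E.
by apply: eq_imset => u; apply/setP=> v; rewrite !inE eq_pm.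
Qed.

(* Vertices of the stack of a diagram in FP_{a,b} on top of one in FP_{b,c}:
   top, middle and bottom rows, in this order. *)
Definition stack_vertex (a b c : nat) := ('I_a + 'I_b + 'I_c)%type.

Section Stack.
Variables a b c : nat.

Definition upper (u : 'I_a + 'I_b) : stack_vertex a b c := inl u.
Definition lower (v : 'I_b + 'I_c) : stack_vertex a b c :=
  match v with inl j => inl (inr j) | inr k => inr k end.
Definition outer (w : 'I_a + 'I_c) : stack_vertex a b c :=
  match w with inl i => inl (inl i) | inr k => inr k end.
Definition middle : {set stack_vertex a b c} :=
  [set inl (inr j) | j in [set: 'I_b]].

Variables (mu : diagram b c) (pi : diagram a b).

Definition stack_rel : rel (stack_vertex a b c) :=
  relU (rel_image upper (same_block pi)) (rel_image lower (same_block mu)).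

Definition nloops : nat := ncomp_in stack_rel middle.

Lemma stack_rel_sym : symmetric stack_rel.
Proof.
move=> x y; rewrite /stack_rel /=.
by congr (_ || _); apply: rel_image_sym; apply: same_block_sym.
Qed.

Definition outer_rel : rel ('I_a + 'I_c) :=
  fun u v => connect stack_rel (outer u) (outer v).

Lemma outer_rel_equiv : {in setT & &, equivalence_rel outer_rel}.
Proof.
move=> x y z _ _ _; split; first exact: connect0.
by move=> xy; apply: (same_connect (sym_connect_sym stack_rel_sym) xy).
Qed.

(* pi is stacked on top of mu. *)
Definition diagram_comp : diagram a c := diagram_of_rel outer_rel_equiv.

End Stack.

Lemma id_rel_equiv a :
  {in [set: 'I_a + 'I_a] & &,
    equivalence_rel (fun u v => match u, v with
      | inl i, inl j | inl i, inr j | inr i, inl j | inr i, inr j => i == j end)}.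
Proof. by move=> [?|?] [?|?] [?|?] _ _ _; split=> // /eqP->. Qed.

(* The blocks are the pairs {i, i'}. *)
Definition diagram_id a : diagram a a := diagram_of_rel (@id_rel_equiv a).

Section DiagramLaws.

Lemma comp_diagram_id a b (mu : diagram a b) :
  diagram_comp mu (diagram_id a) = mu /\ nloops mu (diagram_id a) = 0%N.
Proof.
pose h (x : stack_vertex a a b) : 'I_a + 'I_b :=
  match x with inl (inl i) | inl (inr i) => inl i | inr k => inr k end.
set r := stack_rel mu (diagram_id a).
have r_sym : connect_sym r := sym_connect_sym (stack_rel_sym mu (diagram_id a)).
have top i : connect r (inl (inl i)) (inl (inr i)).
  apply: connect1; apply/orP; left; apply/rel_imageP.
  by exists (inl i), (inr i); rewrite same_block_of_rel.
have con x y : connect r x y = same_block mu (h x) (h y).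
  apply/idP/idP.
    apply: (connect_inv (P := fun y => same_block _ (h x) (h y))).
      exact: same_block_refl.
    move=> {}y z _ xy /orP[]/rel_imageP[u [v [uv yE zE]]].
      suff <- : h y = h z by [].
      rewrite yE zE; move: uv; rewrite same_block_of_rel /=.
      by case: u v {yE zE} => [i|i] [j|j] /eqP->.
    apply: same_block_trans xy _; rewrite yE zE.
    by case: u v uv {yE zE} => [i|i] [j|j].
  have low z : connect r z (@lower a a b (h z)).
    by case: z => [[i|i]|k] /=; rewrite ?connect0 ?top.
  move=> hxy; apply: connect_trans (low x) _.
  rewrite r_sym; apply: connect_trans (low y) _; rewrite r_sym; apply: connect1.
  by apply/orP; right; apply/rel_imageP; exists (h x), (h y).
split.
  by apply: diagram_eq => u v; rewrite same_block_of_rel /outer_rel con; case: u v => ? [].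
apply/eqP; rewrite /nloops /ncomp_in cards_eq0; apply/eqP/setP=> C.
rewrite !inE; apply/negP=> /andP[/componentsP[x ->]] /subsetP sub.
have /sub/imsetP[i _ xE] : x \in [set y | connect r x y] by rewrite inE connect0.
have /sub/imsetP[] // : inl (inl i) \in [set y | connect r x y].
by rewrite inE xE r_sym top.
Qed.

Lemma comp_id_diagram a b (pi : diagram a b) :
  diagram_comp (diagram_id b) pi = pi /\ nloops (diagram_id b) pi = 0%N.
Proof.
pose h (x : stack_vertex a b b) : 'I_a + 'I_b :=
  match x with inl u => u | inr k => inr k end.
set r := stack_rel (diagram_id b) pi.
have r_sym : connect_sym r := sym_connect_sym (stack_rel_sym (diagram_id b) pi).
have bot k : connect r (inl (inr k)) (inr k).
  apply: connect1; apply/orP; right; apply/rel_imageP.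
  by exists (inl k), (inr k); rewrite same_block_of_rel.
have con x y : connect r x y = same_block pi (h x) (h y).
  apply/idP/idP.
    apply: (connect_inv (P := fun y => same_block _ (h x) (h y))).
      exact: same_block_refl.
    move=> {}y z _ xy /orP[]/rel_imageP[u [v [uv yE zE]]].
      by apply: same_block_trans xy _; rewrite yE zE.
    suff <- : h y = h z by [].
    rewrite yE zE; move: uv; rewrite same_block_of_rel /=.
    by case: u v {yE zE} => [i|i] [j|j] /eqP->.
  have upp z : connect r z (@upper a b b (h z)).
    by case: z => [u|k] /=; rewrite ?connect0 // r_sym bot.
  move=> hxy; apply: connect_trans (upp x) _.
  rewrite r_sym; apply: connect_trans (upp y) _; rewrite r_sym; apply: connect1.
  by apply/orP; left; apply/rel_imageP; exists (h x), (h y).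
split.
  by apply: diagram_eq => u v; rewrite same_block_of_rel /outer_rel con; case: u v => ? [].
apply/eqP; rewrite /nloops /ncomp_in cards_eq0; apply/eqP/setP=> C.
rewrite !inE; apply/negP=> /andP[/componentsP[x ->]] /subsetP sub.
have /sub/imsetP[i _ xE] : x \in [set y | connect r x y] by rewrite inE connect0.
have /sub/imsetP[] // : inr i \in [set y | connect r x y].
by rewrite inE xE bot.
Qed.

Variables (a b c d : nat).
Variables (nu : diagram c d) (mu : diagram b c) (pi : diagram a b).

Let W := ('I_a + 'I_b + 'I_c + 'I_d)%type.
Let gl (x : stack_vertex a b c) : W := inl x.
Let fl (x : stack_vertex a c d) : W :=
  match x with inl (inl i) => inl (inl (inl i)) | inl (inr k) => inl (inr k)
  | inr l => inr l end.
Let gr (x : stack_vertex b c d) : W :=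
  match x with inl (inl j) => inl (inl (inr j)) | inl (inr k) => inl (inr k)
  | inr l => inr l end.
Let fr (x : stack_vertex a b d) : W :=
  match x with inl u => inl (inl u) | inr l => inr l end.

Let rl := relU (rel_image gl (stack_rel mu pi))
               (rel_image fl (rel_image (@lower a c d) (same_block nu))).
Let rr := relU (rel_image gr (stack_rel nu mu))
               (rel_image fr (rel_image (@upper a b d) (same_block pi))).

Let rlr : rl =2 rr.
Proof.
move=> x y; apply/idP/idP => /orP[]/rel_imageP[u [v [uv -> ->]]].
- case/orP: uv => /rel_imageP[u' [v' [uv -> ->]]]; apply/orP.
    right; apply/rel_imageP; exists (upper d u'), (upper d v'); split=> //.
    by apply/rel_imageP; exists u', v'.
  left; apply/rel_imageP; exists (upper d u'), (upper d v').
  split; [|by case: u' {uv}|by case: v' {uv}].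
  by apply/orP; left; apply/rel_imageP; exists u', v'.
- case/rel_imageP: uv => [u' [v' [uv -> ->]]]; apply/orP.
  left; apply/rel_imageP; exists (lower b u'), (lower b v').
  split; [|by case: u' {uv}|by case: v' {uv}].
  by apply/orP; right; apply/rel_imageP; exists u', v'.
- case/orP: uv => /rel_imageP[u' [v' [uv -> ->]]]; apply/orP.
    left; apply/rel_imageP; exists (lower a u'), (lower a v').
    split; [|by case: u' {uv}|by case: v' {uv}].
    by apply/orP; right; apply/rel_imageP; exists u', v'.
  right; apply/rel_imageP; exists (lower a u'), (lower a v').
  split; [|by case: u' {uv}|by case: v' {uv}].
  by apply/rel_imageP; exists u', v'.
- case/rel_imageP: uv => [u' [v' [uv -> ->]]]; apply/orP.
  left; apply/rel_imageP; exists (upper c u'), (upper c v'); split=> //.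
  by apply/orP; left; apply/rel_imageP; exists u', v'.
Qed.

Let eq_rel_image (A B : finType) (h : A -> B) r r' :
  r =2 r' -> rel_image h r =2 rel_image h r'.
Proof.
by move=> rr' x y; apply/rel_imageP/rel_imageP => -[u [v [ruv -> ->]]];
  exists u, v; rewrite ?rr' // -rr'.
Qed.

Let eq_ncomp_in (A : finType) (r r' : rel A) (K : {set A}) :
  connect r =2 connect r' -> ncomp_in r K = ncomp_in r' K.
Proof.
move=> rr'; congr #|pred_of_set _|; apply/setP=> C; rewrite !inE; congr (_ && _).
by apply/componentsP/componentsP => -[x ->]; exists x; apply/setP=> y; rewrite !inE rr'.
Qed.

Let sl := relU (rel_image (@upper a c d) (outer_rel mu pi))
               (rel_image (@lower a c d) (same_block nu)).
Let sr := relU (rel_image (@lower a b d) (outer_rel nu mu))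
               (rel_image (@upper a b d) (same_block pi)).

Let stack_sl : stack_rel nu (diagram_comp mu pi) =2 sl.
Proof.
move=> x y; rewrite /stack_rel /sl /=; congr (_ || _).
by apply: eq_rel_image => {}x {}y; rewrite same_block_of_rel.
Qed.

Let stack_sr : stack_rel (diagram_comp nu mu) pi =2 sr.
Proof.
move=> x y; rewrite /stack_rel /sr /= orbC; congr (_ || _).
by apply: eq_rel_image => {}x {}y; rewrite same_block_of_rel.
Qed.

Let lP1 : injective gl. Proof. by move=> x y []. Qed.
Let lP2 : injective fl. Proof. by move=> [[?|?]|?] [[?|?]|?] // [->]. Qed.
Let lP3 o : gl (outer b o) = fl (upper d o). Proof. by case: o. Qed.
Let lP4 u s : gl u = fl s -> exists2 o, u = outer b o & s = upper d o.
Proof.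
case: u s => [[i|j]|k] [[i'|k']|l] //= [] <-;
  by [exists (inl i) | exists (inr k)].
Qed.
Let lP5 x : (exists s, x = fl s) \/ (exists u, x = gl u).
Proof. by case: x => [u|l]; [right; exists u | left; exists (inr l)]. Qed.

Let rP1 : injective gr. Proof. by move=> [[?|?]|?] [[?|?]|?] // [->]. Qed.
Let rP2 : injective fr. Proof. by move=> [?|?] [?|?] // [->]. Qed.
Let rP3 o : gr (outer c o) = fr (lower a o). Proof. by case: o. Qed.
Let rP4 u s : gr u = fr s -> exists2 o, u = outer c o & s = lower a o.
Proof.
case: u s => [[i|j]|k] [[i'|k']|l] //= [] <-;
  by [exists (inl i) | exists (inr k)].
Qed.
Let rP5 x : (exists s, x = fr s) \/ (exists u, x = gr u).
Proof.
case: x => [[u|k]|l]; [left; exists (inl u) | right; exists (inl (inr k)) |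
  left; exists (inr l)]; by [].
Qed.

Lemma diagram_compA :
  diagram_comp nu (diagram_comp mu pi) = diagram_comp (diagram_comp nu mu) pi.
Proof.
apply: diagram_eq => x y; rewrite !same_block_of_rel /outer_rel.
rewrite (eq_connect stack_sl) (eq_connect stack_sr).
rewrite (connect_elim lP1 lP2 lP3 lP4) (connect_elim rP1 rP2 rP3 rP4).
by rewrite (eq_connect rlr); case: x y => ? [].
Qed.

Let nonouter (a' b' c' : nat) :
  middle a' b' c' = [set u | u \notin codom (@outer a' b' c')].
Proof.
apply/setP=> u; rewrite inE; apply/imsetP/idP => [[j _ ->]|].
  by apply/negP=> /codomP[[]].
case: u => [[i|j]|k] n.
- by case/negP: n; apply/codomP; exists (inl i).
- by exists j.
- by case/negP: n; apply/codomP; exists (inr k).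
Qed.

Lemma nloopsA : (nloops mu pi + nloops nu (diagram_comp mu pi)
                 = nloops nu mu + nloops (diagram_comp nu mu) pi)%N.
Proof.
rewrite /nloops (eq_ncomp_in _ (eq_connect stack_sl)).
rewrite (eq_ncomp_in _ (eq_connect stack_sr)).
rewrite (nonouter a b c) (nonouter b c d).
have lsym : symmetric (rel_image (@lower a c d) (same_block nu)).
  by apply: rel_image_sym; apply: same_block_sym.
have rsym : symmetric (rel_image (@upper a b d) (same_block pi)).
  by apply: rel_image_sym; apply: same_block_sym.
rewrite -(ncomp_elim lP1 lP2 lP3 lP4 lP5 (stack_rel_sym mu pi) lsym).
rewrite -(ncomp_elim rP1 rP2 rP3 rP4 rP5 (stack_rel_sym nu mu) rsym).
rewrite (eq_ncomp_in _ (eq_connect rlr)); congr ncomp_in.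
apply/setP=> x; rewrite !inE; apply/orP/orP.
  case=> [/imsetP[_ /imsetP[k _ ->] ->]|].
    by right; apply/negP=> /codomP[[[]|]].
  case: x => [[[i|j]|k]|l] n; last by [case/negP: n; apply/codomP; exists (inr l)].
  - by case/negP: n; apply/codomP; exists (inl (inl i)).
  - by left; apply/imsetP; exists (inl (inr j)) => //; apply/imsetP; exists j.
  - by case/negP: n; apply/codomP; exists (inl (inr k)).
case=> [/imsetP[_ /imsetP[j _ ->] ->]|].
  by right; apply/negP=> /codomP[[[]|]].
case: x => [[[i|j]|k]|l] n; last by [case/negP: n; apply/codomP; exists (inr l)].
- by case/negP: n; apply/codomP; exists (inl (inl i)).
- by case/negP: n; apply/codomP; exists (inl (inr j)).
- by left; apply/imsetP; exists (inl (inr k)) => //; apply/imsetP; exists k.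
Qed.

End DiagramLaws.

Record lcat (F : fieldType) := LCat {
  obj :> Type;
  mor : obj -> obj -> lmodType F;
  idm : forall X, mor X X;
  compm : forall X Y Z, mor Y Z -> mor X Y -> mor X Z;
  compm1 : forall X Y (f : mor X Y), compm f (idm X) = f;
  comp1m : forall X Y (f : mor X Y), compm (idm Y) f = f;
  compmA : forall X Y Z T (h : mor Z T) (g : mor Y Z) (f : mor X Y),
    compm h (compm g f) = compm (compm h g) f;
  comp_linearl : forall X Y Z (f : mor X Y), linear (fun g : mor Y Z => compm g f);
  comp_linearr : forall X Y Z (g : mor Y Z), linear (fun f : mor X Y => compm g f)
}.

Arguments mor {F C} X Y : rename.
Arguments idm {F C} X : rename.
Arguments compm {F C X Y Z} g f : rename.

Record functor_data (F : fieldType) (C D : lcat F) := FunctorData {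
  fobj : C -> D;
  fmor : forall X Y : C, mor X Y -> mor (fobj X) (fobj Y)
}.

Arguments FunctorData {F C D} fobj fmor.
Arguments fobj {F C D} f X : rename.
Arguments fmor {F C D} f {X Y} u : rename.

Record lfunctor (F : fieldType) (C D : lcat F) := LFunctor {
  fdata :> functor_data C D;
  fmor_id : forall X : C, fmor fdata (idm X) = idm (fobj fdata X);
  fmor_comp : forall (X Y Z : C) (g : mor Y Z) (f : mor X Y),
    fmor fdata (compm g f) = compm (fmor fdata g) (fmor fdata f);
  fmor_linear : forall X Y : C, linear (fun f : mor X Y => fmor fdata f)
}.

Definition faithful (F : fieldType) (C D : lcat F) (Phi : lfunctor C D) : Prop :=
  forall X Y : C, injective (fun f : mor X Y => fmor Phi f).

Section LinearLemmas.
Variables (F : fieldType) (V W : lmodType F) (f : V -> W).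
Hypothesis f_lin : linear f.

Lemma lin0 : f 0 = 0.
Proof.
have := f_lin 1 0 0; rewrite !scale1r addr0 => /esym/eqP.
by rewrite -subr_eq0 addrK => /eqP.
Qed.

Lemma linD u v : f (u + v) = f u + f v.
Proof. by have := f_lin 1 u v; rewrite !scale1r. Qed.

Lemma linZ k u : f (k *: u) = k *: f u.
Proof. by have := f_lin k u 0; rewrite lin0 !addr0. Qed.

Lemma linB u v : f (u - v) = f u - f v.
Proof. by rewrite -[- v]scaleN1r linD linZ scaleN1r. Qed.

Lemma lin_sum (I : finType) (h : I -> V) : f (\sum_i h i) = \sum_i f (h i).
Proof. by apply: (big_morph f linD lin0). Qed.

End LinearLemmas.

Section CompLemmas.
Variables (F : fieldType) (C : lcat F) (X Y Z : C).

Lemma comp0m (f : mor X Y) : compm (0 : mor Y Z) f = 0.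
Proof. exact: lin0 (comp_linearl f). Qed.

Lemma compm0 (g : mor Y Z) : compm g (0 : mor X Y) = 0.
Proof. exact: lin0 (comp_linearr g). Qed.

Lemma comp_suml (I : finType) (h : I -> mor Y Z) (f : mor X Y) :
  compm (\sum_i h i) f = \sum_i compm (h i) f.
Proof. exact: (lin_sum (comp_linearl f) h). Qed.

Lemma comp_sumr (I : finType) (g : mor Y Z) (h : I -> mor X Y) :
  compm g (\sum_i h i) = \sum_i compm g (h i).
Proof. exact: (lin_sum (comp_linearr g) h). Qed.

End CompLemmas.

Section FfunProd.
Variables (F : fieldType) (I : finType) (V : I -> lmodType F).

Definition ffprod := {dffun forall i : I, V i}.
HB.instance Definition _ := Choice.on ffprod.

Implicit Types f g : ffprod.

Definition ffprod_zero : ffprod := [ffun i : I => 0 : V i].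
Definition ffprod_opp f : ffprod := [ffun i : I => - f i : V i].
Definition ffprod_add f g : ffprod := [ffun i : I => f i + g i : V i].
Definition ffprod_scale (k : F) f : ffprod := [ffun i : I => k *: f i : V i].

Fact ffprod_addA : associative ffprod_add.
Proof. by move=> f g h; apply/ffunP=> i; rewrite !ffunE addrA. Qed.
Fact ffprod_addC : commutative ffprod_add.
Proof. by move=> f g; apply/ffunP=> i; rewrite !ffunE addrC. Qed.
Fact ffprod_add0 : left_id ffprod_zero ffprod_add.
Proof. by move=> f; apply/ffunP=> i; rewrite !ffunE add0r. Qed.
Fact ffprod_addN : left_inverse ffprod_zero ffprod_opp ffprod_add.
Proof. by move=> f; apply/ffunP=> i; rewrite !ffunE addNr. Qed.

HB.instance Definition _ := GRing.isZmodule.Build ffprod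
  ffprod_addA ffprod_addC ffprod_add0 ffprod_addN.

Fact ffprod_scaleA k l f :
  ffprod_scale k (ffprod_scale l f) = ffprod_scale (k * l) f.
Proof. by apply/ffunP=> i; rewrite !ffunE scalerA. Qed.
Fact ffprod_scale1 : left_id 1 ffprod_scale.
Proof. by move=> f; apply/ffunP=> i; rewrite !ffunE scale1r. Qed.
Fact ffprod_scaleDr : right_distributive ffprod_scale +%R.
Proof. by move=> k f g; apply/ffunP=> i; rewrite !ffunE scalerDr. Qed.
Fact ffprod_scaleDl f : {morph ffprod_scale^~ f : k l / k + l}.
Proof. by move=> k l; apply/ffunP=> i; rewrite !ffunE scalerDl. Qed.

HB.instance Definition _ := GRing.Zmodule_isLmodule.Build F ffprod
  ffprod_scaleA ffprod_scale1 ffprod_scaleDr ffprod_scaleDl.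

Lemma ffprodDE f g i : (f + g) i = f i + g i.
Proof. by rewrite ffunE. Qed.

Lemma ffprodZE k f i : (k *: f) i = k *: f i.
Proof. by rewrite ffunE. Qed.

End FfunProd.

Section Additive.
Variables (F : fieldType) (C : lcat F).

(* Formal finite direct sums; the empty sum is allowed. *)
Record add_obj := AddObj { add_size : nat; summand :> 'I_add_size -> C }.

Implicit Types X Y Z T : add_obj.

(* Matrices of morphisms, indexed by (column, row) = (source, target). *)
Definition add_hom X Y : lmodType F :=
  ffprod (fun ij : 'I_(add_size X) * 'I_(add_size Y) => mor (X ij.1) (Y ij.2)).

Definition add_mx X Y (E : forall i j, mor (X i) (Y j)) : add_hom X Y :=
  [ffun ij : 'I_(add_size X) * 'I_(add_size Y) =>
     E ij.1 ij.2 : mor (X ij.1) (Y ij.2)].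

Definition entry X Y (f : add_hom X Y) i j : mor (X i) (Y j) :=
  (f : {dffun forall ij : 'I_(add_size X) * 'I_(add_size Y),
          mor (X ij.1) (Y ij.2)}) (i, j).

(* The identity if i = j, and 0 otherwise. *)
Definition kronecker X (i j : 'I_(add_size X)) : mor (X i) (X j) :=
  if i =P j is ReflectT e
  then eq_rect i (fun k => mor (X i) (X k) : Type) (idm (X i)) j e else 0.

Definition add_id X : add_hom X X := add_mx (@kronecker X).

Definition add_comp X Y Z (g : add_hom Y Z) (f : add_hom X Y) : add_hom X Z :=
  add_mx (fun i k => \sum_j compm (entry g j k) (entry f i j)).

Lemma entryE X Y (E : forall i j, mor (X i) (Y j)) i j :
  entry (add_mx E) i j = E i j.
Proof. by rewrite /entry ffunE. Qed.

Lemma entryP X Y (f g : add_hom X Y) :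
  (forall i j, entry f i j = entry g i j) -> f = g.
Proof. by move=> fg; apply/ffunP=> -[i j]; apply: fg. Qed.

Lemma entry_linear X Y i j : linear (fun f : add_hom X Y => entry f i j).
Proof. by move=> k f g; rewrite /entry ffprodDE ffprodZE. Qed.

Lemma kronecker_refl X i : kronecker i i = idm (X i).
Proof. by rewrite /kronecker; case: eqP => // e; rewrite (eq_axiomK e). Qed.

Lemma kronecker_neq X (i j : 'I_(add_size X)) : i != j -> kronecker i j = 0.
Proof. by rewrite /kronecker; case: eqP. Qed.

Lemma add_compm1 X Y (f : add_hom X Y) : add_comp f (add_id X) = f.
Proof.
apply: entryP => i j; rewrite entryE (bigD1 i) //= entryE kronecker_refl compm1.
rewrite big1 ?addr0 // => k; rewrite eq_sym => ik.
by rewrite entryE kronecker_neq // compm0.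
Qed.

Lemma add_comp1m X Y (f : add_hom X Y) : add_comp (add_id Y) f = f.
Proof.
apply: entryP => i j; rewrite entryE (bigD1 j) //= entryE kronecker_refl comp1m.
by rewrite big1 ?addr0 // => k kj; rewrite entryE kronecker_neq // comp0m.
Qed.

Lemma add_compA X Y Z T (h : add_hom Z T) (g : add_hom Y Z) (f : add_hom X Y) :
  add_comp h (add_comp g f) = add_comp (add_comp h g) f.
Proof.
apply: entryP => i l; rewrite !entryE.
under eq_bigr => k _ do rewrite entryE comp_sumr.
rewrite exchange_big /=; apply: eq_bigr => j _.
by rewrite entryE comp_suml; apply: eq_bigr => k _; rewrite compmA.
Qed.

Lemma add_comp_linearl X Y Z (f : add_hom X Y) :
  linear (fun g : add_hom Y Z => add_comp g f).
Proof.
move=> a g h; apply: entryP => i k; rewrite entry_linear !entryE.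
rewrite scaler_sumr -big_split; apply: eq_bigr => j _ /=.
by rewrite entry_linear comp_linearl.
Qed.

Lemma add_comp_linearr X Y Z (g : add_hom Y Z) :
  linear (fun f : add_hom X Y => add_comp g f).
Proof.
move=> a f h; apply: entryP => i k; rewrite entry_linear !entryE.
rewrite scaler_sumr -big_split; apply: eq_bigr => j _ /=.
by rewrite entry_linear comp_linearr.
Qed.

Definition additive_envelope : lcat F :=
  @LCat F add_obj add_hom add_id add_comp add_compm1 add_comp1m add_compA
    add_comp_linearl add_comp_linearr.

End Additive.

Section AdditiveFunctor.
Variables (F : fieldType) (C D : lcat F) (Phi : lfunctor C D).

Definition add_fobj (X : additive_envelope C) : additive_envelope D :=
  @AddObj F D (add_size X) (fun i => fobj Phi (X i)).

Definition add_fmor (X Y : additive_envelope C) (f : mor X Y) :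
    mor (add_fobj X) (add_fobj Y) :=
  @add_mx F D (add_fobj X) (add_fobj Y) (fun i j => fmor Phi (entry f i j)).

Lemma add_fmor_id (X : additive_envelope C) :
  add_fmor (idm X) = idm (add_fobj X).
Proof.
apply: entryP => i j; rewrite !entryE.
have [<-|ij] := eqVneq i j; first by rewrite !kronecker_refl fmor_id.
by rewrite !kronecker_neq // (lin0 (@fmor_linear _ _ _ Phi _ _)).
Qed.

Lemma add_fmor_comp (X Y Z : additive_envelope C) (g : mor Y Z) (f : mor X Y) :
  add_fmor (compm g f) = compm (add_fmor g) (add_fmor f).
Proof.
apply: entryP => i k; rewrite !entryE (lin_sum (@fmor_linear _ _ _ Phi _ _)).
by apply: eq_bigr => j _; rewrite fmor_comp !entryE.
Qed.

Lemma add_fmor_linear (X Y : additive_envelope C) :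
  linear (fun f : mor X Y => add_fmor f).
Proof.
move=> a f g; apply: entryP => i j.
by rewrite entry_linear !entryE entry_linear fmor_linear.
Qed.

Definition additive_functor :
    lfunctor (additive_envelope C) (additive_envelope D) :=
  @LFunctor F _ _ (FunctorData add_fobj add_fmor)
    add_fmor_id add_fmor_comp add_fmor_linear.

End AdditiveFunctor.

Section Karoubi.
Variables (F : fieldType) (C : lcat F).

Record kar_obj := KarObj {
  kobj : C;
  kidem : mor kobj kobj;
  kidemP : compm kidem kidem = kidem
}.

Implicit Types X Y Z T : kar_obj.

Section Hom.
Variables X Y : kar_obj.

Definition kar_pred : {pred mor (kobj X) (kobj Y)} :=
  fun f => compm (kidem Y) (compm f (kidem X)) == f.

Lemma kar_pred_closed : submod_closed kar_pred.
Proof.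
split=> [|a f g]; rewrite !unfold_in ?comp0m ?compm0 //.
by move=> /eqP ff /eqP gg; rewrite comp_linearl comp_linearr ff gg.
Qed.

HB.instance Definition _ :=
  GRing.isSubmodClosed.Build F (mor (kobj X) (kobj Y)) kar_pred kar_pred_closed.

Record kar_mor := KarMor { kval : mor (kobj X) (kobj Y); _ : kval \in kar_pred }.

HB.instance Definition _ := [isSub for kval].
HB.instance Definition _ := [Choice of kar_mor by <:].
HB.instance Definition _ := [SubChoice_isSubLmodule of kar_mor by <:].

(* e' Hom(X, Y) e, for objects (X, e) and (Y, e'). *)
Definition kar_hom : lmodType F := kar_mor.

Lemma kvalP (f : kar_hom) : compm (kidem Y) (compm (kval f) (kidem X)) = kval f.
Proof. exact/eqP/(valP f). Qed.

Lemma kval_linear : linear (fun f : kar_hom => kval f).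
Proof. by []. Qed.

End Hom.

Arguments kar_pred : clear implicits.

Lemma kval_idr X Y (f : kar_hom X Y) : compm (kval f) (kidem X) = kval f.
Proof. by rewrite -{1}kvalP -!compmA kidemP kvalP. Qed.

Lemma kval_idl X Y (f : kar_hom X Y) : compm (kidem Y) (kval f) = kval f.
Proof. by rewrite -{1}kvalP compmA kidemP kvalP. Qed.

Lemma kar_id_subproof X : kidem X \in kar_pred X X.
Proof. by rewrite unfold_in !kidemP. Qed.

Definition kar_id X : kar_hom X X := KarMor (kar_id_subproof X).

Lemma kar_comp_subproof X Y Z (g : kar_hom Y Z) (f : kar_hom X Y) :
  compm (kval g) (kval f) \in kar_pred X Z.
Proof. by rewrite unfold_in -compmA kval_idr compmA kval_idl. Qed.

Definition kar_comp X Y Z (g : kar_hom Y Z) (f : kar_hom X Y) : kar_hom X Z :=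
  KarMor (kar_comp_subproof g f).

Lemma kar_compm1 X Y (f : kar_hom X Y) : kar_comp f (kar_id X) = f.
Proof. by apply: val_inj; apply: kval_idr. Qed.

Lemma kar_comp1m X Y (f : kar_hom X Y) : kar_comp (kar_id Y) f = f.
Proof. by apply: val_inj; apply: kval_idl. Qed.

Lemma kar_compA X Y Z T (h : kar_hom Z T) (g : kar_hom Y Z) (f : kar_hom X Y) :
  kar_comp h (kar_comp g f) = kar_comp (kar_comp h g) f.
Proof. by apply: val_inj; apply: compmA. Qed.

Lemma kar_comp_linearl X Y Z (f : kar_hom X Y) :
  linear (fun g : kar_hom Y Z => kar_comp g f).
Proof. by move=> a g h; apply: val_inj; apply: comp_linearl. Qed.

Lemma kar_comp_linearr X Y Z (g : kar_hom Y Z) :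
  linear (fun f : kar_hom X Y => kar_comp g f).
Proof. by move=> a f h; apply: val_inj; apply: comp_linearr. Qed.

Definition karoubi_envelope : lcat F :=
  @LCat F kar_obj kar_hom kar_id kar_comp kar_compm1 kar_comp1m kar_compA
    kar_comp_linearl kar_comp_linearr.

End Karoubi.

Arguments kar_pred {F C} X Y.

Section KaroubiFunctor.
Variables (F : fieldType) (C D : lcat F) (Phi : lfunctor C D).

Lemma kar_fobj_subproof (X : karoubi_envelope C) :
  compm (fmor Phi (kidem X)) (fmor Phi (kidem X)) = fmor Phi (kidem X).
Proof. by rewrite -fmor_comp kidemP. Qed.

Definition kar_fobj (X : karoubi_envelope C) : karoubi_envelope D :=
  KarObj (kar_fobj_subproof X).

Lemma kar_fmor_subproof (X Y : karoubi_envelope C) (f : mor X Y) :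
  fmor Phi (kval f) \in kar_pred (kar_fobj X) (kar_fobj Y).
Proof. by rewrite unfold_in /= -!fmor_comp kvalP. Qed.

Definition kar_fmor (X Y : karoubi_envelope C) (f : mor X Y) :
    mor (kar_fobj X) (kar_fobj Y) :=
  KarMor (kar_fmor_subproof f).

Lemma kar_fmor_id (X : karoubi_envelope C) : kar_fmor (idm X) = idm (kar_fobj X).
Proof. by apply: val_inj. Qed.

Lemma kar_fmor_comp (X Y Z : karoubi_envelope C) (g : mor Y Z) (f : mor X Y) :
  kar_fmor (compm g f) = compm (kar_fmor g) (kar_fmor f).
Proof. by apply: val_inj; apply: fmor_comp. Qed.

Lemma kar_fmor_linear (X Y : karoubi_envelope C) :
  linear (fun f : mor X Y => kar_fmor f).
Proof. by move=> a f g; apply: val_inj; apply: (@fmor_linear _ _ _ Phi). Qed.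

Definition karoubi_functor : lfunctor (karoubi_envelope C) (karoubi_envelope D) :=
  @LFunctor F _ _ (FunctorData kar_fobj kar_fmor)
    kar_fmor_id kar_fmor_comp kar_fmor_linear.

End KaroubiFunctor.

Section PartitionCategory.
Variables (F : fieldType) (t : F).

(* The space with basis the partition diagrams; F^o is F as a vector space. *)
Definition FP (a b : nat) : vectType F := {ffun diagram a b -> F^o}.

Definition FP_basis a b (pi : diagram a b) : FP a b :=
  [ffun mu => (mu == pi)%:R : F^o].

Definition FP_coef a b (f : FP a b) (pi : diagram a b) : F :=
  (f : {ffun diagram a b -> F^o}) pi.

Definition FP_comp a b c (g : FP b c) (f : FP a b) : FP a c :=
  \sum_mu \sum_pi (FP_coef g mu * FP_coef f pi * t ^+ nloops mu pi)
    *: FP_basis (diagram_comp mu pi).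

Definition FP_id a : FP a a := FP_basis (diagram_id a).

Lemma FP_coef_linear a b pi : linear (fun f : FP a b => FP_coef f pi : F^o).
Proof. by move=> k f g; rewrite /FP_coef !ffunE. Qed.

Lemma FP_coef_basis a b (pi mu : diagram a b) :
  FP_coef (FP_basis pi) mu = (mu == pi)%:R.
Proof. by rewrite /FP_coef ffunE. Qed.

Lemma FP_expand a b (f : FP a b) : f = \sum_pi FP_coef f pi *: FP_basis pi.
Proof.
apply/ffunP=> mu; rewrite -/(FP_coef f mu) -[RHS]/(FP_coef _ mu).
rewrite (lin_sum (FP_coef_linear mu)) (bigD1 mu) //= big1 => [|pi pm].
  by rewrite (linZ (FP_coef_linear mu)) FP_coef_basis eqxx addr0 [RHS]mulr1.
by rewrite (linZ (FP_coef_linear mu)) FP_coef_basis eq_sym (negPf pm) scaler0.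
Qed.

Lemma FP_comp_linearl a b c (f : FP a b) :
  linear (fun g : FP b c => FP_comp g f).
Proof.
move=> k g h; rewrite /FP_comp scaler_sumr -big_split; apply: eq_bigr => mu _ /=.
rewrite scaler_sumr -big_split; apply: eq_bigr => pi _ /=.
by rewrite FP_coef_linear scalerA -scalerDl !mulrDl -!mulrA.
Qed.

Lemma FP_comp_linearr a b c (g : FP b c) :
  linear (fun f : FP a b => FP_comp g f).
Proof.
move=> k f h; rewrite /FP_comp scaler_sumr -big_split; apply: eq_bigr => mu _ /=.
rewrite scaler_sumr -big_split; apply: eq_bigr => pi _ /=.
rewrite FP_coef_linear scalerA -scalerDl mulrDr mulrDl !mulrA.
by congr ((_ * _ * _ + _) *: _); rewrite mulrC.
Qed.

Lemma FP_comp_basis a b c (mu : diagram b c) (pi : diagram a b) :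
  FP_comp (FP_basis mu) (FP_basis pi)
  = t ^+ nloops mu pi *: FP_basis (diagram_comp mu pi).
Proof.
rewrite /FP_comp (bigD1 mu) //= [X in _ + X]big1 ?addr0 => [|nu nm]; last first.
  by rewrite big1 // => pi' _; rewrite FP_coef_basis (negPf nm) !mul0r scale0r.
rewrite (bigD1 pi) //= big1 ?addr0 => [|pi' np].
  by rewrite !FP_coef_basis !eqxx !mul1r.
by rewrite !FP_coef_basis (negPf np) mulr0 mul0r scale0r.
Qed.

Lemma FP_ext a b (V : lmodType F) (u v : FP a b -> V) :
  linear u -> linear v -> (forall pi, u (FP_basis pi) = v (FP_basis pi)) -> u =1 v.
Proof.
move=> lu lv uv f; rewrite [f]FP_expand (lin_sum lu) (lin_sum lv).
by apply: eq_bigr => pi _; rewrite (linZ lu) (linZ lv) uv.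
Qed.

Lemma FP_compm1 a b (f : FP a b) : FP_comp f (FP_id a) = f.
Proof.
move: f; apply: FP_ext => [||mu]; [exact: FP_comp_linearl | by [] |].
by rewrite FP_comp_basis; have [-> ->] := comp_diagram_id mu; rewrite scale1r.
Qed.

Lemma FP_comp1m a b (f : FP a b) : FP_comp (FP_id b) f = f.
Proof.
move: f; apply: FP_ext => [||pi]; [exact: FP_comp_linearr | by [] |].
by rewrite FP_comp_basis; have [-> ->] := comp_id_diagram pi; rewrite scale1r.
Qed.

Lemma FP_compA a b c d (h : FP c d) (g : FP b c) (f : FP a b) :
  FP_comp h (FP_comp g f) = FP_comp (FP_comp h g) f.
Proof.
move: h; apply: FP_ext => [||nu].
- exact: FP_comp_linearl.
- by move=> k u v; rewrite !FP_comp_linearl.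
move: g; apply: FP_ext => [||mu].
- by move=> k u v; rewrite FP_comp_linearl FP_comp_linearr.
- by move=> k u v; rewrite FP_comp_linearr FP_comp_linearl.
move: f; apply: FP_ext => [||pi].
- by move=> k u v; rewrite !FP_comp_linearr.
- exact: FP_comp_linearr.
rewrite !FP_comp_basis (linZ (FP_comp_linearr _)) (linZ (FP_comp_linearl _)).
by rewrite !FP_comp_basis !scalerA -!exprD nloopsA diagram_compA.
Qed.

(* The object [n] is the natural number n. *)
Definition Rep0 : lcat F :=
  @LCat F nat FP FP_id FP_comp FP_compm1 FP_comp1m FP_compA
    FP_comp_linearl FP_comp_linearr.

Definition Rep : lcat F := karoubi_envelope (additive_envelope Rep0).

Definition degree (x : nat * nat) : int := x.1%:Z - x.2%:Z.

Definition gr_FP (x y : nat * nat) : {vspace FP (x.1 + x.2) (y.1 + y.2)} :=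
  if degree x == degree y then fullv else 0%VS.

Lemma gr_FP_id x : FP_id (x.1 + x.2) \in gr_FP x x.
Proof. by rewrite /gr_FP eqxx memvf. Qed.

Lemma gr_FP_comp x y z g f :
  g \in gr_FP y z -> f \in gr_FP x y -> FP_comp g f \in gr_FP x z.
Proof.
rewrite /gr_FP; case: (degree x =P degree y) => [->|_].
  case: ifP => _; first by rewrite !memvf.
  by rewrite !memv0 => /eqP-> _; rewrite (lin0 (FP_comp_linearl _)).
rewrite [f \in _]memv0 => _ /eqP->.
by rewrite (lin0 (FP_comp_linearr _)) mem0v.
Qed.

Definition gr_hom x y : lmodType F := subvs_of (gr_FP x y).

Definition gr_id x : gr_hom x x := Subvs (gr_FP_id x).

Definition gr_comp x y z (g : gr_hom y z) (f : gr_hom x y) : gr_hom x z :=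
  Subvs (gr_FP_comp (subvsP g) (subvsP f)).

Lemma gr_compm1 x y (f : gr_hom x y) : gr_comp f (gr_id x) = f.
Proof. by apply: val_inj; apply: FP_compm1. Qed.

Lemma gr_comp1m x y (f : gr_hom x y) : gr_comp (gr_id y) f = f.
Proof. by apply: val_inj; apply: FP_comp1m. Qed.

Lemma gr_compA x y z w (h : gr_hom z w) (g : gr_hom y z) (f : gr_hom x y) :
  gr_comp h (gr_comp g f) = gr_comp (gr_comp h g) f.
Proof. by apply: val_inj; apply: FP_compA. Qed.

Lemma gr_comp_linearl x y z (f : gr_hom x y) :
  linear (fun g : gr_hom y z => gr_comp g f).
Proof. by move=> k g h; apply: val_inj; apply: FP_comp_linearl. Qed.

Lemma gr_comp_linearr x y z (g : gr_hom y z) :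
  linear (fun f : gr_hom x y => gr_comp g f).
Proof. by move=> k f h; apply: val_inj; apply: FP_comp_linearr. Qed.

(* The object [a,b] is the pair (a, b). The parameter q only affects the
   braiding and the twist, which are not part of the linear category. *)
Definition grRep0 (q : F) : lcat F :=
  @LCat F (nat * nat)%type gr_hom gr_id gr_comp gr_compm1 gr_comp1m gr_compA
    gr_comp_linearl gr_comp_linearr.

Definition grRep (q : F) : lcat F :=
  karoubi_envelope (additive_envelope (grRep0 q)).

End PartitionCategory.

(* Main.v *)
Require Import Defs.
From mathcomp Require Import all_boot all_order all_algebra.

(** The morphisms from [a,b] to [c,d] in the graded category form a subspace of
    the space of partition diagrams from a+b to c+d points, and identities and
    composition are those of diagrams. Hence the inclusions of these subspaces
    form a linear functor, which is faithful because they are injective.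

    Faithfulness survives both envelopes for the same reason: a morphism of the
    envelope is determined by underlying morphisms of the original category, and
    the induced functor acts on these. For the additive envelope they are the
    entries of a matrix ([additive_functor_faithful]); for the Karoubi envelope
    it is the single morphism between the objects carrying the idempotents
    ([karoubi_functor_faithful]). *)

Import GRing.Theory.
Local Open Scope ring_scope.

Lemma additive_functor_faithful (F : fieldType) (C D : lcat F)
    (Phi : lfunctor C D) :
  faithful Phi -> faithful (additive_functor Phi).
Proof.
move=> injPhi X Y f g /= fg; apply: entryP => i j; apply: (injPhi).
have /= := congr1 (fun h : mor (add_fobj Phi X) (add_fobj Phi Y) => entry h i j) fg.
by rewrite !entryE.
Qed.

Lemma karoubi_functor_faithful (F : fieldType) (C D : lcat F)
    (Phi : lfunctor C D) :
  faithful Phi -> faithful (karoubi_functor Phi).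
Proof.
by move=> injPhi X Y f g /= /(congr1 val) /injPhi fg; apply: val_inj.
Qed.

Section ForgetDegree.
Variables (F : fieldType) (t q : F).

Definition forget_degree_data : functor_data (grRep0 t q) (Rep0 t) :=
  FunctorData (C := grRep0 t q) (D := Rep0 t)
    (fun ab => (ab.1 + ab.2)%N) (fun _ _ f => vsval f).

Definition forget_degree : lfunctor (grRep0 t q) (Rep0 t) :=
  @LFunctor F _ _ forget_degree_data
    (fun _ => erefl) (fun _ _ _ _ _ => erefl) (fun _ _ _ _ _ => erefl).

Lemma forget_degree_faithful : faithful forget_degree.
Proof. by move=> X Y; apply: val_inj. Qed.

End ForgetDegree.

Theorem proposition6p1 (F : fieldType) (charF0 : [pchar F] =i pred0)
    (t q : F) (q_neq0 : q != 0) :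
  exists (F0 : lfunctor (grRep0 t q) (Rep0 t))
         (FF : lfunctor (grRep t q) (Rep t)),
    [/\ fdata F0 = FunctorData (C := grRep0 t q) (D := Rep0 t)
                     (fun ab => (ab.1 + ab.2)%N) (fun _ _ f => vsval f),
        FF = karoubi_functor (additive_functor F0)
      & faithful FF].
Proof.
exists (forget_degree F t q).
exists (karoubi_functor (additive_functor (forget_degree F t q))).
split=> //; apply: karoubi_functor_faithful; apply: additive_functor_faithful.
exact: forget_degree_faithful.
Qed.
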